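(* Let $Q>1$, let $(X,d)$ be a $Q$-doubling metric space, and let $G\subsetneq X$ be a domain. Then the following statements are equivalent: (i) $G$ is length uniform; (ii) $G$ is diameter uniform and locally quasiconvex; (iii) $G$ is distance uniform and locally quasiconvex.
   Context: A domain is a nonempty open connected set. For $G\subsetneq X$ put $\delta_G(z)=\inf\{d(z,y): y\in X\setminus G\}$. $B(x,r)=\{y\in X: d(x,y)<r\}$. A curve is a continuous map $\gamma:[a,b]\to X$, identified with its image when convenient; it joins $x$ and $y$ if $\gamma(a)=x$, $\gamma(b)=y$; its length is $\ell(\gamma)=\sup\sum_i d(\gamma(t_i),\gamma(t_{i-1}))$ over all partitions of $[a,b]$, and $\gamma$ is rectifiable if $\ell(\gamma)<\infty$. For points $u,v$ on $\gamma$, $\gamma[u,v]$ is the subcurve with endpoints $u,v$ (points on $\gamma$ are understood together with their parameter values, so for $z=\gamma(t)$, $\gamma[x,z]=\gamma|_{[a,t]}$ and $\gamma[z,y]=\gamma|_{[t,b]}$). A domain $G$ is rectifiably connected if every two points of $G$ can be joined by a rectifiable curve in $G$. $Q$-doubling: for each ball $B(x,r)$, every $r/2$-separated subset of $B(x,r)$ has cardinality at most $Q$, where a set $S$ is $\sigma$-separated if $d(u,v)\ge\sigma$ for all distinct $u,v\in S$. Locally $(q,\lambda)$-quasiconvex ($0<q<1$, $\lambda\ge1$): $G$ is rectifiably connected and for every $x\in G$ and all $y,z\in B(x,q\,\delta_G(x))$ there is a curve $\gamma$ in $G$ joining $y$ and $z$ with $\ell(\gamma)\le\lambda\, d(y,z)$.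 Locally quasiconvex means locally $(q,\lambda)$-quasiconvex for some such $q,\lambda$. Let $c\ge1$. $G$ is length $c$-uniform if every pair $x,y\in G$ can be joined by a rectifiable curve $\gamma\subset G$ with $\ell(\gamma)\le c\,d(x,y)$ and $\min\{\ell(\gamma[x,z]),\ell(\gamma[z,y])\}\le c\,\delta_G(z)$ for all $z\in\gamma$. $G$ is diameter $c$-uniform if every pair $x,y\in G$ can be joined by a rectifiable curve $\gamma\subset G$ with $\operatorname{diam}(\gamma)\le c\,d(x,y)$ and $\min\{\operatorname{diam}(\gamma[x,z]),\operatorname{diam}(\gamma[z,y])\}\le c\,\delta_G(z)$ for all $z\in\gamma$. $G$ is distance $c$-uniform if every pair $x,y\in G$ can be joined by a rectifiable curve $\gamma\subset G$ with $\operatorname{diam}(\gamma)\le c\,d(x,y)$ and $\min\{d(x,z),d(z,y)\}\le c\,\delta_G(z)$ for all $z\in\gamma$. $G$ is length (diameter, distance) uniform if it is so for some $c\ge1$. *)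

(* Defs.v *)
From mathcomp Require Import all_boot all_order all_algebra.
From mathcomp Require Import all_classical all_reals all_analysis.
Set Implicit Arguments.
Unset Strict Implicit.
Unset Printing Implicit Defensive.
Import Order.TTheory GRing.Theory Num.Theory.
Import numFieldNormedType.Exports.
Local Open Scope classical_set_scope.
Local Open Scope ring_scope.

Section uniform_domains.
Context {R : realType} {X : metricType R}.
Implicit Types (G S A : set X) (g : R -> X).

Definition domain G := [/\ G !=set0, open G & connected G].

(* The infimum is that of a nonempty set when G is a proper subset of X. *)
Definition bdist G (z : X) : R := inf [set mdist z y | y in ~` G].

Definition separated_by (s : R) S :=
  forall u v, S u -> S v -> u != v -> s <= mdist u v.

(* Q is a real number, so "at most Q elements" reads: S is finite with n
   elements and n <= Q. *)
Definition doubling (Q : R) :=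
  forall (x : X) (r : R) S, 0 < r -> S `<=` ball x r ->
    separated_by (r / 2) S -> exists2 n : nat, (S #= `I_n)%card & n%:R <= Q.

(* A curve is given by a triple a, b, g with g : R -> X continuous on [a, b];
   the values of g outside [a, b] are irrelevant. *)
Definition curve_in G (a b : R) g (x y : X) :=
  [/\ a <= b, {within `[a, b], continuous g}, g a = x, g b = y
    & g @` `[a, b] `<=` G].

(* The metric counterpart of [variation], which is restricted to real-valued
   functions: the points of the partition are those of a :: s. *)
Definition mvariation (a b : R) g (s : seq R) : R :=
  let F := g \o nth b (a :: s) in
  \sum_(0 <= n < size s) mdist (F n.+1) (F n).

Definition curve_length (a b : R) g : \bar R :=
  ereal_sup [set (mvariation a b g s)%:E | s in itv_partition a b].

Definition rectifiable (a b : R) g := (curve_length a b g < +oo)%E.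

Definition diameter A : \bar R :=
  ereal_sup [set (mdist u v)%:E | u in A & v in A].

Definition curve_diam (a b : R) g : \bar R := diameter (g @` `[a, b]).

Definition rectifiably_connected G := forall x y, G x -> G y ->
  exists a b g, curve_in G a b g x y /\ rectifiable a b g.

Definition locally_quasiconvex_with (q lambda : R) G :=
  rectifiably_connected G /\
  forall x y z, G x ->
    ball x (q * bdist G x) y -> ball x (q * bdist G x) z ->
    exists a b g, curve_in G a b g y z /\
      (curve_length a b g <= (lambda * mdist y z)%:E)%E.

Definition locally_quasiconvex G := exists q lambda : R,
  [/\ 0 < q, q < 1, 1 <= lambda & locally_quasiconvex_with q lambda G].

Definition length_uniform_with (c : R) G := forall x y, G x -> G y ->
  exists a b g, [/\ curve_in G a b g x y, rectifiable a b g,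
    (curve_length a b g <= (c * mdist x y)%:E)%E
    & forall t, t \in `[a, b] ->
        (Order.min (curve_length a t g) (curve_length t b g)
           <= (c * bdist G (g t))%:E)%E].

Definition diameter_uniform_with (c : R) G := forall x y, G x -> G y ->
  exists a b g, [/\ curve_in G a b g x y, rectifiable a b g,
    (curve_diam a b g <= (c * mdist x y)%:E)%E
    & forall t, t \in `[a, b] ->
        (Order.min (curve_diam a t g) (curve_diam t b g)
           <= (c * bdist G (g t))%:E)%E].

Definition distance_uniform_with (c : R) G := forall x y, G x -> G y ->
  exists a b g, [/\ curve_in G a b g x y, rectifiable a b g,
    (curve_diam a b g <= (c * mdist x y)%:E)%E
    & forall t, t \in `[a, b] ->
        Order.min (mdist x (g t)) (mdist (g t) y) <= c * bdist G (g t)].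

Definition length_uniform G :=
  exists2 c : R, 1 <= c & length_uniform_with c G.

Definition diameter_uniform G :=
  exists2 c : R, 1 <= c & diameter_uniform_with c G.

Definition distance_uniform G :=
  exists2 c : R, 1 <= c & distance_uniform_with c G.

End uniform_domains.

Arguments doubling {R} X Q.

(* Main.v *)
(* The substance is that distance uniform and locally quasiconvex imply length
   uniform.  Two points u, v at distance at most 2 rho whose distances to the
   boundary are comparable to rho are joined by a distance uniform curve, which
   stays at depth comparable to rho.  By doubling, boundedly many points chosen
   along it suffice for consecutive ones to be so close that local
   quasiconvexity joins them; this gives a curve of length O(rho) at depth
   comparable to rho.  On a distance uniform curve from x to y pick, for
   rho = |x - y| / 2^k, a point at distance rho from x, hence at depth at least
   rho / c.  Joining consecutive points, and x itself to the first of them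
   within a small multiple of delta_G(x), the lengths form a geometric series, which
   gives a length cigar from x to a point at distance |x - y| / 2; the same is
   done from y and the two ends are joined. *)

Require Import Defs.
From mathcomp Require Import all_boot all_order all_algebra.
From mathcomp Require Import all_classical all_reals all_analysis.
From mathcomp Require Import finmap ring lra.
Set Implicit Arguments.
Unset Strict Implicit.
Unset Printing Implicit Defensive.
Import Order.TTheory GRing.Theory Num.Theory.
Import numFieldNormedType.Exports.
Local Open Scope classical_set_scope.
Local Open Scope ring_scope.

(** * Counting separated points in a doubling space *)

Section separated_sequences.
Context {R : realType} {X : metricType R}.
Implicit Types (s : R) (l : seq X).

(** Equal entries at different positions are compared too, so for [0 < s] repetitions are excluded
    and [size l] is a cardinality. *)
Definition separated_seq s l := pairwise (fun u v => s <= mdist u v) l.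

Lemma separated_seq_mdist s l u v : separated_seq s l ->
  u \in l -> v \in l -> u != v -> s <= mdist u v.
Proof.
elim: l => //= w l IH /andP[/allP wl sl]; rewrite !inE.
move=> /predU1P[->|ul] /predU1P[->|vl]; rewrite ?eqxx//.
- by move=> _; exact: wl.
- by move=> _; rewrite metric_sym; exact: wl.
- exact: IH.
Qed.

Lemma separated_seq_uniq s l : 0 < s -> separated_seq s l -> uniq l.
Proof.
by move=> s0; apply: pairwise_uniq => u; rewrite mdistxx leNgt s0.
Qed.

Lemma separated_seq_filter s (p : pred X) l :
  separated_seq s l -> separated_seq s [seq u <- l | p u].
Proof. exact/subseq_pairwise/filter_subseq. Qed.

(** Greedy selection: an entry is kept exactly when no entry already kept lies within [s] of it. *)
Lemma separated_net s l : 0 < s -> exists t, [/\ {subset t <= l},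
  separated_seq s t & forall u, u \in l -> has (fun v => mdist v u < s) t].
Proof.
move=> s0; elim: l => [|u l [t [tl st lt]]]; first by exists [::].
have [ut|/hasPn ut] := boolP (has (fun v => mdist v u < s) t).
  exists t; split=> // [v /tl vl|v]; first by rewrite inE vl orbT.
  by rewrite inE => /predU1P[->|/lt].
exists (u :: t); split=> /=.
- by move=> v; rewrite !inE => /predU1P[->|/tl ->]; rewrite ?eqxx ?orbT.
- apply/andP; split=> //; apply/allP => v /ut.
  by rewrite -leNgt metric_sym.
- by move=> v; rewrite inE => /predU1P[->|/lt ->]; rewrite ?mdistxx ?s0 ?orbT.
Qed.

Lemma size_covered (I T : Type) (p : I -> pred T) (t : seq I) (l : seq T) n :
  all (fun u => has (p^~ u) t) l -> (forall i, count (p i) l <= n)%N ->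
  (size l <= size t * n)%N.
Proof.
elim: t l => [|i t IH] l /=; first by case: l.
move=> lt ln; rewrite -(count_predC (p i) l) mulSn leq_add// -size_filter.
apply: IH => [|j].
  rewrite all_filter; apply: sub_all lt => u /=.
  by case: (p i u).
rewrite count_filter; apply: leq_trans (ln j).
by apply: sub_count => u /= /andP[].
Qed.

Lemma doubling_seq (Q : R) (x : X) (r : R) l : doubling X Q -> 0 < r ->
  {in l, forall u, mdist x u < r} -> separated_seq (r / 2) l ->
  (size l)%:R <= Q.
Proof.
move=> hX r0 lx sl; have [||n ln nQ] := hX x r [set` l] r0.
- by move=> u /= /lx; rewrite ballEmdist.
- by move=> u v; exact: separated_seq_mdist.
suff -> : size l = n by [].
have : ([set` [fset u in l]%fset] #= `I_n)%card.
  by congr (_ #= _)%card: ln; apply/seteqP; split=> u /=; rewrite inE.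
move/card_eq_fsetP; rewrite card_fseq undup_id//.
by apply: separated_seq_uniq sl; rewrite divr_gt0.
Qed.

(** Each halving of the radius costs a factor [n]: a net at scale [2 ^+ k * s] has at most [n]
    points by doubling, and the induction hypothesis counts the entries near each of them. At
    [k = 0], doubling is applied at radius [2 * s], whose half is the separation [s]. *)
Lemma doubling_iter (Q : R) (n k : nat) (x : X) s l : doubling X Q ->
  Q <= n%:R -> 0 < s -> {in l, forall u, mdist x u < 2 ^+ k * s} ->
  separated_seq s l ->
  (size l <= n ^ k.+1)%N.
Proof.
move=> hX Qn s0; elim: k x l => [|k IH] x l lx sl.
  rewrite expn1 -(ler_nat R); apply: le_trans Qn.
  apply: (doubling_seq (r := 2 * s) (x := x) hX); first by lra.
    by move=> u /lx; lra.
  by rewrite mulrAC divff ?mul1r// pnatr_eq0.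
have r0 : 0 < 2 ^+ k * s by rewrite mulr_gt0// exprn_gt0.
have [t [tl st lt]] := separated_net l r0.
rewrite expnS; apply: (@leq_trans (size t * n ^ k.+1)); last first.
  rewrite leq_mul2r -(ler_nat R); apply/orP; right; apply: le_trans Qn.
  apply: (doubling_seq (r := 2 ^+ k.+1 * s) (x := x) hX).
  - by rewrite mulr_gt0// exprn_gt0.
  - by move=> u /tl/lx.
  - by congr separated_seq: st; rewrite exprS; field.
apply: (@size_covered _ _ (fun v u => mdist v u < 2 ^+ k * s)) => [|v].
  exact/allP.
rewrite -size_filter; apply: (IH v) => [u|].
  by rewrite mem_filter => /andP[].
exact: separated_seq_filter.
Qed.

End separated_sequences.

(** * Length of curves and control functions *)

Section controlled_curves.
Context {R : realType} {X : metricType R}.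
Implicit Types (a b s t : R) (g : R -> X) (h : R -> R).

Lemma mvariation_nil a b g : mvariation a b g [::] = 0.
Proof. by rewrite /mvariation big_geq. Qed.

Lemma mvariation_cons a b g x p :
  mvariation a b g (x :: p) = mdist (g x) (g a) + mvariation x b g p.
Proof. by rewrite /mvariation /= big_nat_recl. Qed.

Lemma mvariation_rcons a b c g p : itv_partition a b p ->
  mvariation a c g (rcons p c) = mvariation a b g p + mdist (g c) (g b).
Proof.
elim: p a => [|x p IH] a.
  move=> /itv_partition_nil ->.
  by rewrite mvariation_cons !mvariation_nil addrC.
move=> /itv_partition_cons /IH /=; rewrite !mvariation_cons => ->.
by rewrite addrA.
Qed.

(* [h] plays the role of arc length; carrying it along replaces every
   manipulation of partitions when curves are restricted, reversed or joined. *)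
Definition controlled a b g h := forall s t, a <= s -> s <= t -> t <= b ->
  mdist (g s) (g t) <= h t - h s.

Lemma controlled_le a b g h s t : controlled a b g h ->
  a <= s -> s <= t -> t <= b -> h s <= h t.
Proof.
by move=> gh ? ? ?; rewrite -subr_ge0 (le_trans (mdist_ge0 _ _) (gh s t _ _ _)).
Qed.

Lemma controlled_length a b g h s t : controlled a b g h ->
  a <= s -> s <= t -> t <= b -> (curve_length s t g <= (h t - h s)%:E)%E.
Proof.
move=> gh als st tb; apply: ge_ereal_sup => _ /= [p tp <-]; rewrite lee_fin.
elim: p s als st tp => [|x p IH] s als st.
  by move=> /itv_partition_nil ->; rewrite mvariation_nil subrr.
move=> sxp; have xp := itv_partition_cons sxp; have xt := itv_partition_le xp.
have sx : s <= x by case: sxp => /= /andP[/ltW].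
rewrite mvariation_cons metric_sym.
have := IH x (le_trans als sx) xt xp.
by have := gh s x als sx (le_trans xt tb); lra.
Qed.

(** A partition of [[a, s]] is prolonged by the point [t]. Partitions increase strictly, hence the
    separate case [s = t]. *)
Lemma curve_length_add a s t g : a <= s -> s <= t ->
  (curve_length a s g + (mdist (g s) (g t))%:E <= curve_length a t g)%E.
Proof.
move=> als; rewrite le_eqVlt => /predU1P[<-|st]; first by rewrite mdistxx adde0.
rewrite -leeBrDr//; apply: ge_ereal_sup => _ [p asp <-].
rewrite leeBrDr// -EFinD metric_sym -mvariation_rcons//.
apply: ereal_sup_ubound; exists (rcons p t) => //=.
by rewrite -cats1; apply: itv_partition_cat asp _; exact: itv_partition1.
Qed.

Lemma curve_lengthxx a g : curve_length a a g = 0%E.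
Proof.
rewrite /curve_length -[RHS]ereal_sup1; congr ereal_sup.
apply/seteqP; split=> [_ [p /itv_partitionxx -> <-]|_ ->] /=.
  by rewrite mvariation_nil.
by exists [::]; rewrite ?mvariation_nil//; split=> /=.
Qed.

Lemma curve_length_ge0 a t g : a <= t -> (0 <= curve_length a t g)%E.
Proof.
move=> at_; apply: le_trans (curve_length_add g (lexx a) at_).
by rewrite curve_lengthxx add0e lee_fin mdist_ge0.
Qed.

Lemma le_curve_length a s t g : a <= s -> s <= t ->
  (curve_length a s g <= curve_length a t g)%E.
Proof.
move=> als st; apply: le_trans (curve_length_add g als st).
by rewrite leeDl// lee_fin mdist_ge0.
Qed.

(** Arc length is itself a control; rectifiability makes it finite, so that [fine] loses nothing.
    With [controlled_length], bounds on length and on controls become interchangeable. *)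
Lemma controlled_arclength a b g : rectifiable a b g ->
  controlled a b g (fun t => fine (curve_length a t g)).
Proof.
move=> gb s t als st tb.
have fin u : a <= u -> u <= b -> curve_length a u g \is a fin_num.
  move=> au ub; rewrite ge0_fin_numE ?curve_length_ge0//.
  exact: le_lt_trans (le_curve_length g au ub) gb.
have fs := fin s als (le_trans st tb); have ft := fin t (le_trans als st) tb.
rewrite lerBrDl -lee_fin EFinD !fineK//.
exact: curve_length_add.
Qed.

End controlled_curves.

(** * Continuity under reparametrization and gluing *)

Section curve_continuity.
Context {R : realType} {X : metricType R}.
Implicit Types (a b s t : R) (g : R -> X).

Lemma within_itv_continuousP a b g : {within `[a, b], continuous g} <->
  forall t, t \in `[a, b] -> forall e, 0 < e -> exists2 d, 0 < d &
    forall s, s \in `[a, b] -> `|t - s| < d -> mdist (g t) (g s) < e.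
Proof.
rewrite subspace_continuousP; split=> gc t /[dup] tab /gc {}gc.
  move=> e e0; have /gc : nbhs (g t) (ball (g t) e) by exact: nbhsx_ballx.
  rewrite /= !nbhs_simpl /= => -[d /= d0 tdg]; exists d => // s sab tsd.
  by have := tdg s tsd sab; rewrite ballEmdist.
move=> A /nbhs_ballP[e /= e0 eA]; rewrite nbhs_simpl /=.
have [d d0 tdg] := gc _ e0; exists d => //= s /= tsd sab; apply: eA.
by rewrite ballEmdist; exact: tdg.
Qed.

(** As [f] is 1-Lipschitz, the same delta serves. Agreement of [g'] with [g \o f] is asked only on
    [[a', b']], which suits curves defined by cases. *)
Lemma within_continuous_reparam a b a' b' g g' (f : R -> R) :
  (forall t, t \in `[a', b'] -> f t \in `[a, b] /\ g' t = g (f t)) ->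
  (forall s t, `|f s - f t| <= `|s - t|) ->
  {within `[a, b], continuous g} -> {within `[a', b'], continuous g'}.
Proof.
move=> fab f1 /within_itv_continuousP gc; apply/within_itv_continuousP.
move=> t /fab[ft ->] e e0; have [d d0 td] := gc _ ft _ e0; exists d => // s.
by move=> /fab[fs ->] ts; apply: td => //; exact: le_lt_trans (f1 _ _) ts.
Qed.

Lemma within_continuous_glue a b c g : a <= b -> b <= c ->
  {within `[a, b], continuous g} -> {within `[b, c], continuous g} ->
  {within `[a, c], continuous g}.
Proof.
move=> ab bc gab gbc.
have -> : `[a, c]%classic = `[a, b] `|` `[b, c].
  apply/seteqP; split=> t /=; rewrite !in_itv /=.
    by move=> /andP[-> ->]; rewrite andbT; exact/orP/le_total.
  move=> [/andP[-> tb]|/andP[bt ->]]; rewrite ?andbT/= ?(le_trans tb)//.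
  exact: le_trans bt.
by apply: withinU_continuous => //; exact: itv_closed.
Qed.

End curve_continuity.

(** * Reversing, joining and weakening connections *)

Section connections.
Context {R : realType} {X : metricType R}.
Implicit Types (a b s t r l m L M : R) (g : R -> X) (h : R -> R) (u v w z : X).

(* [P z r r'] constrains a point [z] of the curve together with the lengths [r]
   and [r'] of the parts of the curve before and after [z]. *)
Definition conn (P : X -> R -> R -> Prop) u v L := exists a b g h,
  [/\ curve_in [set: X] a b g u v, controlled a b g h, h a = 0, h b <= L &
    forall t, t \in `[a, b] -> P (g t) (h t) (h b - h t)].

Lemma conn_rev P u v L :
  conn P u v L -> conn (fun z r r' => P z r' r) v u L.
Proof.
move=> [a [b [g [h [[ab gc ga gb _] gh ha hb gP]]]]].
exists (- b), (- a), (fun t => g (- t)), (fun t => h b - h (- t)); split=> /=.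
- split; rewrite /= ?lerN2 ?opprK//.
  apply: (within_continuous_reparam (f := fun t => - t)) gc => [t|s t].
    by rewrite !in_itv /= => tab; split=> //; lra.
  by rewrite -opprD normrN.
- move=> s t bs st ta; rewrite metric_sym.
  have : mdist (g (- t)) (g (- s)) <= h (- s) - h (- t) by apply: gh; lra.
  by lra.
- by rewrite opprK subrr.
- by rewrite opprK ha subr0.
- move=> t tab; rewrite opprK ha subr0 opprB addrC subrK.
  by apply: gP; move: tab; rewrite !in_itv /=; lra.
Qed.

(** Joining adds the length [m] of the second piece behind each point of the first, and the length
    [l] of the first before each point of the second; the two hypotheses say that the constraints
    survive this. *)
Lemma conn_cat P P' P'' u v w L M :
  (forall z r (r' : R) m, 0 <= m <= M -> P z r r' -> P'' z r (r' + m)) ->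
  (forall z r (r' : R) l, 0 <= l <= L -> P' z r r' -> P'' z (l + r) r') ->
  conn P u v L -> conn P' v w M -> conn P'' u w (L + M).
Proof.
move=> PP P'P [a1 [b1 [g1 [h1 [[ab1 gc1 ga1 gb1 _] gh1 ha1 hb1 gP1]]]]].
move=> [a2 [b2 [g2 [h2 [[ab2 gc2 ga2 gb2 _] gh2 ha2 hb2 gP2]]]]].
(* The second curve is shifted to start at [b1]. Both branches agree there, since both curves pass
   through [v] and [h2 a2 = 0]. *)
pose f t := t - b1 + a2; pose B := b1 + (b2 - a2).
pose g t := if t <= b1 then g1 t else g2 (f t).
pose h t := if t <= b1 then h1 t else h1 b1 + h2 (f t).
have gl t : t <= b1 -> g t = g1 t by rewrite /g => ->.
have hl t : t <= b1 -> h t = h1 t by rewrite /h => ->.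
have gr t : b1 <= t -> g t = g2 (f t).
  rewrite le_eqVlt /g leNgt => /predU1P[<-|->//].
  by rewrite ltxx /f subrr add0r gb1 ga2.
have hr t : b1 <= t -> h t = h1 b1 + h2 (f t).
  rewrite le_eqVlt /h leNgt => /predU1P[<-|->//].
  by rewrite ltxx /f subrr add0r ha2 addr0.
have fB : f B = b2 by rewrite /f /B; ring.
have bB : b1 <= B by rewrite /B; lra.
have gB : g B = w by rewrite gr// fB.
have hB : h B = h1 b1 + h2 b2 by rewrite hr// fB.
have h1b : 0 <= h1 b1 by rewrite -ha1; apply: (controlled_le gh1).
have h2b : 0 <= h2 b2 by rewrite -ha2; apply: (controlled_le gh2).
exists a1, B, g, h; split.
- split; rewrite ?[g a1]gl//; first exact: le_trans bB.
  apply: within_continuous_glue ab1 bB _ _.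
    apply: (within_continuous_reparam (f := id)) gc1 => // t.
    by rewrite in_itv /= => /[dup] + /andP[_ tb]; rewrite gl.
  apply: (within_continuous_reparam (f := f)) gc2 => [t|s t].
    rewrite in_itv /= => /andP[bt tB]; rewrite gr//; split=> //.
    by rewrite in_itv /=; move: bt tB; rewrite /f /B => *; apply/andP; lra.
  by rewrite /f; have -> : s - b1 + a2 - (t - b1 + a2) = s - t by ring.
- have ctr s t : b1 <= s -> s <= t -> t <= B ->
      mdist (g s) (g t) <= h t - h s.
    move=> bs st tB; rewrite !gr ?hr//; try exact: le_trans st.
    have : mdist (g2 (f s)) (g2 (f t)) <= h2 (f t) - h2 (f s).
      by apply: gh2; move: bs st tB; rewrite /f /B; lra.
    by lra.
  move=> s t als st tB.
  have [tb|/ltW bt] := leP t b1.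
    by rewrite !gl ?hl ?(le_trans st)//; exact: gh1.
  have [sb|/ltW bs] := leP s b1; last exact: ctr.
  apply: le_trans (metric_triangle _ (g b1) _) _.
  have := ctr b1 t (lexx _) bt tB; rewrite [g b1]gl// [h b1]hl//.
  rewrite [g s]gl// [h s]hl//.
  by have := gh1 s b1 als sb (lexx _); lra.
- by rewrite hl.
- by rewrite hB; lra.
move=> t; rewrite in_itv /= hB => /andP[at_ tB].
have [tb|/ltW bt] := leP t b1.
  rewrite gl// hl// addrAC; apply: PP; first by rewrite h2b.
  by apply: gP1; rewrite in_itv /= at_.
rewrite gr// hr// opprD addrACA subrr add0r; apply: P'P; first by rewrite h1b.
apply: gP2; rewrite in_itv /=.
by move: bt tB; rewrite /f /B => *; apply/andP; lra.
Qed.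

Lemma conn_sub P P' u v L L' : conn P u v L -> L <= L' ->
  (forall z r (r' : R), 0 <= r <= L -> P z r r' -> P' z r r') -> conn P' u v L'.
Proof.
move=> [a [b [g [h [gi gh ha hb gP]]]]] LL' PP'; exists a, b, g, h; split=> //.
  exact: le_trans LL'.
move=> t tab; apply: (PP' _ _ _ _ (gP t tab)).
move: tab; rewrite in_itv /= => /andP[at_ tb].
by rewrite -ha (controlled_le gh)//= (le_trans _ hb)// (controlled_le gh).
Qed.

(** Passes from controls back to genuine lengths. Curves of [conn] range over the whole space, so
    the constraint carries membership in [G]. *)
Lemma conn_length (G : set X) P u v L :
  conn (fun z r r' => G z /\ P z r r') u v L ->
  exists a b g, [/\ curve_in G a b g u v, (curve_length a b g <= L%:E)%E
    & forall t, t \in `[a, b] -> exists r r', [/\ P (g t) r r',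
      (curve_length a t g <= r%:E)%E & (curve_length t b g <= r'%:E)%E]].
Proof.
move=> [a [b [g [h [[ab gc ga gb _] gh ha hb gP]]]]]; exists a, b, g; split.
- by split=> // _ [t /gP[? _] <-].
- apply: le_trans (controlled_length gh (lexx a) ab (lexx b)) _.
  by rewrite lee_fin ha subr0.
move=> t /[dup] /gP[_ tP]; rewrite in_itv /= => /andP[at_ tb].
exists (h t), (h b - h t); split=> //.
  by rewrite -[h t]subr0 -ha; exact: (controlled_length gh).
exact: (controlled_length gh).
Qed.

Lemma length_conn (G : set X) a b g u v L : curve_in G a b g u v ->
  (curve_length a b g <= L%:E)%E ->
  conn (fun z r r' => G z /\ mdist u z <= r) u v L.
Proof.
move=> [ab gc ga gb gG] gL.
have grect : rectifiable a b g by exact: le_lt_trans gL (ltry _).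
have gh := controlled_arclength grect.
exists a, b, g, (fun t => fine (curve_length a t g)); split=> //.
- by rewrite curve_lengthxx.
- rewrite -lee_fin fineK// ge0_fin_numE// curve_length_ge0//.
move=> t tab; split; first by apply: gG; exists t.
move: tab; rewrite in_itv /= => /andP[at_ tb].
by have := gh a t (lexx a) at_ tb; rewrite curve_lengthxx subr0 ga.
Qed.

End connections.

(** * Distance to the boundary *)

Section boundary_distance.
Context {R : realType} {X : metricType R} (G : set X).
Implicit Types z w : X.

Lemma bdist_ge0 z : 0 <= bdist G z.
Proof.
rewrite /bdist; set D := (X in inf X).
(* The infimum of the empty set is 0 by convention. *)
have [->|/set0P D0] := eqVneq D set0; first by rewrite inf0.
by apply: lb_le_inf => // _ [y _ <-]; exact: mdist_ge0.
Qed.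

Lemma bdist_le z y : ~ G y -> bdist G z <= mdist z y.
Proof.
move=> Gy; apply: ge_inf; last by exists y.
by exists 0 => _ [w _ <-]; exact: mdist_ge0.
Qed.

Lemma mem_lt_bdist z w : mdist z w < bdist G z -> G w.
Proof. by move=> zw; apply: contrapT => /(bdist_le z); rewrite leNgt zw. Qed.

Lemma bdist_triangle z w : ~` G !=set0 -> bdist G z <= bdist G w + mdist z w.
Proof.
move=> [y0 Gy0]; rewrite -lerBlDr; apply: lb_le_inf.
  by exists (mdist w y0), y0.
move=> _ [y Gy <-]; rewrite lerBlDr addrC.
exact: le_trans (bdist_le z Gy) (metric_triangle _ _ _).
Qed.

Lemma bdist_gt0 z : open G -> ~` G !=set0 -> G z -> 0 < bdist G z.
Proof.
move=> oG [y0 Gy0] Gz.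
have /nbhs_ballP[e /= e0 eG] : nbhs z G by exact: open_nbhs_nbhs.
apply: lt_le_trans e0 _; apply: lb_le_inf; first by exists (mdist z y0), y0.
move=> _ [y Gy <-]; rewrite leNgt; apply/negP => zy; apply: Gy; apply: eG.
by rewrite ballEmdist.
Qed.

End boundary_distance.

(** * Chains of boundedly many links along a curve *)

Section chains.
Context {R : realType} {X : metricType R}.

(* Greedy choice: the next link starts at the last point of the curve within
   distance [s] of the current one, so the points chosen are [s]-separated. *)
Lemma greedy_chain (J : X -> X -> R -> Prop) (a b s L : R) (g : R -> X) n t0 :
  (forall u v w L1 L2, J u v L1 -> J v w L2 -> J u w (L1 + L2)) ->
  (forall t t', t \in `[a, b] -> t' \in `[a, b] -> mdist (g t) (g t') <= s ->
    J (g t) (g t') L) ->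
  0 < s -> {within `[a, b], continuous g} -> t0 \in `[a, b] ->
  (forall l, separated_seq s l ->
    {in l, forall u, exists2 t, t \in `[t0, b] & g t = u} -> (size l <= n)%N) ->
  exists2 m, (m <= n)%N & J (g t0) (g b) (m%:R * L).
Proof.
move=> Jtrans Jlink s0 /within_itv_continuousP gc.
elim: n t0 => [|n IH] t0 /[dup] t0ab; rewrite in_itv /= => /andP[at0 t0b] sep.
  (* For the bound 0 the hypothesis is contradictory: one point alone is a separated sequence. *)
  suff : (size [:: g b] <= 0)%N by [].
  apply: sep => // u; rewrite inE => /eqP ->.
  by exists b; rewrite // in_itv /= lexx t0b.
(* The supremum [t1] of [S] is the next stop; continuity from the left shows that it still satisfies
   the distance bound. *)
pose S := [set t | t \in `[t0, b] /\ mdist (g t0) (g t) <= s].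
have St0 : S t0 by split; rewrite ?in_itv/= ?lexx ?t0b// mdistxx ltW.
have ubS : ubound S b by move=> t [] + _; rewrite in_itv /= => /andP[].
have hS : has_sup S by split; [exists t0|exists b].
pose t1 := sup S.
have t01 : t0 <= t1 by apply: ub_le_sup => //; case: hS.
have t1b : t1 <= b by apply: ge_sup => //; case: hS.
have t1ab : t1 \in `[a, b] by rewrite in_itv /= t1b (le_trans at0).
have st1 : mdist (g t0) (g t1) <= s.
  apply/ler_addgt0Pr => e e0; have [d d0 dP] := gc t1 t1ab e e0.
  have [t [tt0b ts] t1d] := sup_adherent d0 hS.
  have tt1 : t <= t1 by apply: ub_le_sup => //; case: hS.
  have tab : t \in `[a, b].
    by move: tt0b; rewrite !in_itv /= => /andP[/(le_trans at0) -> ->].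
  have := dP t tab; rewrite ger0_norm ?subr_ge0// => /(_ _)/ltW.
  rewrite ltrBlDr -ltrBlDl => /(_ t1d); rewrite metric_sym => gt.
  by apply: le_trans (metric_triangle _ (g t) _) _; exact: lerD.
have [t1eb|] := eqVneq t1 b.
  exists 1%N => //; rewrite mul1r -t1eb; apply: Jlink => //.
rewrite eq_sym => bt1; have t1ltb : t1 < b by rewrite lt_neqAle eq_sym bt1.
have far_gt t : t1 < t -> t <= b -> s < mdist (g t0) (g t).
  move=> t1t tb; rewrite ltNge; apply/negP => st.
  suff : t <= t1 by rewrite leNgt t1t.
  apply: ub_le_sup; first by case: hS.
  by split=> //; rewrite in_itv /= tb (le_trans t01)// ltW.
(* Times just after [t1] are farther than [s] from [g t0], and continuity passes this to [t1]. The
   increment [Num.min (d / 2) (b - t1)] stays both within delta and inside [[a, b]]. *)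
have far1 : s <= mdist (g t0) (g t1).
  apply/ler_addgt0Pr => e e0; have [d d0 dP] := gc t1 t1ab e e0.
  pose t := t1 + Num.min (d / 2) (b - t1).
  have m0 : 0 < Num.min (d / 2) (b - t1) by rewrite lt_min divr_gt0//= subr_gt0.
  have md : Num.min (d / 2) (b - t1) <= d / 2 by rewrite ge_min lexx.
  have mb : Num.min (d / 2) (b - t1) <= b - t1 by rewrite ge_min lexx orbT.
  have tb : t <= b by rewrite /t; lra.
  have tt1 : t1 < t by rewrite ltrDl.
  have tab : t \in `[a, b].
    by rewrite in_itv /= tb (le_trans at0)// (le_trans t01)// ltW.
  have tg : mdist (g t1) (g t) < e.
    by apply: dP => //; rewrite distrC gtr0_norm ?subr_gt0// /t; lra.
  apply: ltW; apply: lt_le_trans (far_gt t tt1 tb) _.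
  by apply: le_trans (metric_triangle _ (g t1) _) _; rewrite lerD2l ltW.
(* Everything from [t1] on is at distance at least [s] from [g t0], so [g t0] can be prefixed to any
   separated sequence found there: the bound drops by one. *)
have [] := IH t1 => //.
  move=> l sl lt; rewrite -ltnS; apply: (sep (g t0 :: l)).
    apply/andP; split=> //; apply/allP => _ /lt[t + <-].
    rewrite in_itv /= le_eqVlt => /andP[/predU1P[<-//|t1t] tb].
    by apply: ltW; exact: far_gt.
  move=> u; rewrite inE => /predU1P[->|/lt[t t1t <-]].
    by exists t0; rewrite // in_itv /= lexx t0b.
  exists t => //; move: t1t; rewrite !in_itv /=.
  by move=> /andP[/(le_trans t01) -> ->].
move=> m mn Jm; exists m.+1 => //; rewrite -natr1 mulrDl mul1r addrC.
by apply: Jtrans Jm; exact: Jlink.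
Qed.
End chains.

(** * From distance uniform and locally quasiconvex to length uniform *)

Section distance_to_length.
Context {R : realType} {X : metricType R} (G : set X) (Q q lambda c : R).
Hypotheses (Xdbl : doubling X Q) (oG : open G) (ntG : ~` G !=set0).
Hypotheses (q0 : 0 < q) (q1 : q < 1) (lambda1 : 1 <= lambda) (c1 : 1 <= c).
Hypotheses (Gqc : locally_quasiconvex_with q lambda G).
Hypothesis (Gdist : distance_uniform_with c G).

(** The quasiconvex curve has length at most [q * bdist G p / 2], hence cannot use up more than half
    of the depth of [p]. *)
Lemma quasiconvex_link p p' : G p -> 2 * lambda * mdist p p' <= q * bdist G p ->
  conn (fun z _ _ => G z /\ bdist G p / 2 <= bdist G z) p p'
    (lambda * mdist p p').
Proof.
move=> Gp pp'; have dp := bdist_gt0 oG ntG Gp.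
have d0 := mdist_ge0 p p'.
have qd : 0 < q * bdist G p by rewrite mulr_gt0.
have qd1 : q * bdist G p <= bdist G p by rewrite ger_pMl// ltW.
have ld : mdist p p' <= lambda * mdist p p' by rewrite ler_peMl.
have [|||a [b [g [gi gL]]]] := Gqc.2 p p p' => //.
- by rewrite ballEmdist /= mdistxx.
- by rewrite ballEmdist /=; lra.
apply: conn_sub (length_conn gi gL) (lexx _) _ => z r _ /andP[_ rL] [Gz zr].
by split=> //; have := bdist_triangle p z ntG; lra.
Qed.

(** The intermediate value theorem gives a point at distance [rho] from [x] on a distance uniform
    curve. It is at least as far from [y], so the minimum in the cigar condition is at least
    [rho]. *)
Lemma deep_point_at x y (rho : R) :
  G x -> G y -> 0 < rho -> 2 * rho <= mdist x y ->
  exists u, [/\ G u, mdist x u = rho & rho <= c * bdist G u].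
Proof.
move=> Gx Gy rho0 rhoxy; have [a [b [g [gi _ _ gc]]]] := Gdist Gx Gy.
have [ab gcont ga gb gG] := gi.
have [||t tab gt] := @IVT R (fun t => mdist x (g t)) a b rho ab.
- apply/(@within_itv_continuousP R R^o) => t tab e e0.
  have [d d0 td] := (within_itv_continuousP _ _ _).1 gcont t tab e e0.
  exists d => // s sab /(td s sab) ts.
  suff : `|mdist x (g s) - mdist x (g t)| < e by []; rewrite ltr_norml.
  have := metric_triangle x (g t) (g s); have := metric_triangle x (g s) (g t).
  by rewrite (metric_sym (g s)); lra.
- rewrite ga gb mdistxx ge_min le_max ltW//=; apply/orP; right.
  by lra.
exists (g t); split=> //; first by apply: gG; exists t.
apply: le_trans (gc t tab); rewrite le_min gt lexx /=.
by have := metric_triangle x (g t) y; rewrite gt; lra.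
Qed.

Lemma mdist_curve_diam a b (g : R -> X) s t : s \in `[a, b] -> t \in `[a, b] ->
  ((mdist (g s) (g t))%:E <= curve_diam a b g)%E.
Proof.
move=> sab tab; apply: ereal_sup_ubound.
by exists (g s); [exists s|exists (g t) => //; exists t].
Qed.

(** The factors 2 leave room for points chosen at scale [rho / 2]. One [C] bounds both length and
    depth. *)
Definition deep_connection (C : R) := forall (rho : R) u v,
  0 < rho -> G u -> G v -> mdist u v <= 2 * rho ->
  rho <= 2 * c * bdist G u -> rho <= 2 * c * bdist G v ->
  conn (fun z _ _ => G z /\ rho <= C * bdist G z) u v (C * rho).

Lemma deep_points_connected : exists2 C, 1 <= C & deep_connection C.
Proof.
have c0 : 0 < c by exact: lt_le_trans c1.
have l0 : 0 < lambda by exact: lt_le_trans lambda1.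
pose N := Num.bound `|Q|.
have QN : Q <= N%:R.
  apply: le_trans (ler_norm _) (ltW _).
  by apply: archi_boundP; exact: normr_ge0.
(* The number bounded here is the ratio of [2 * c * rho], which bounds the diameter of the curve
   below, to the spacing [s]. *)
pose k := Num.bound (16 * c ^+ 3 * lambda / q).
have hk : 16 * c ^+ 3 * lambda / q < 2 ^+ k by exact: upper_nthrootP.
pose n := (N ^ k.+1)%N.
have c2 : 1 <= c ^+ 2 by rewrite expr_ge1// ltW.
(* The first term accounts for depth, the second for at most [n] links of length at most [rho]. *)
exists (8 * c ^+ 2 + n%:R); first by rewrite ler_wpDr ?ler0n//; lra.
move=> rho u v rho0 Gu Gv uv ru rv.
have [a [b [g [gi _ gdiam gcig]]]] := Gdist Gu Gv.
have [ab gcont ga gb gG] := gi.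
have ain : a \in `[a, b] by rewrite in_itv /= lexx.
have Gg t : t \in `[a, b] -> G (g t) by move=> tab; apply: gG; exists t.
(* A point within [c] times its own depth of an end [w] satisfies
   [bdist G w <= (1 + c) * bdist G (g t)], and [1 + c <= 2 * c]. *)
have gdeep t : t \in `[a, b] -> rho <= 4 * c ^+ 2 * bdist G (g t).
  move=> tab; have d0 := bdist_ge0 G (g t).
  have cd : bdist G (g t) <= c * bdist G (g t) by rewrite ler_peMl.
  have ccd : c * bdist G (g t) <= c * (c * bdist G (g t)).
    by rewrite ler_peMl// mulr_ge0// ltW.
  have deep w : G w -> mdist w (g t) <= c * bdist G (g t) ->
      rho <= 2 * c * bdist G w -> rho <= 4 * c ^+ 2 * bdist G (g t).
    move=> Gw wt rw; have := bdist_triangle w (g t) ntG => wd.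
    have : c * bdist G w <= c * (bdist G (g t) + c * bdist G (g t)).
      by rewrite ler_pM2l//; lra.
    by rewrite expr2; lra.
  have := gcig t tab; rewrite ge_min => /orP[ut|vt]; first exact: (deep u).
  by apply: (deep v) => //; rewrite metric_sym.
(* By [gdeep], this makes [2 * lambda * s] at most [q * bdist G (g t)], as [quasiconvex_link]
   requires. The link halves the depth, whence the 8 in [D]. *)
pose s := q * rho / (8 * c ^+ 2 * lambda).
have c20 : 0 < c ^+ 2 by rewrite exprn_gt0.
have s0 : 0 < s by rewrite /s divr_gt0 ?mulr_gt0.
have ls : lambda * s = q * rho / (8 * c ^+ 2).
  by rewrite /s; field; rewrite !gt_eqF.
have qrho : q * rho <= rho by rewrite ger_pMl// ltW.
pose D z := G z /\ rho <= 8 * c ^+ 2 * bdist G z.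
have [] := @greedy_chain R X (conn (fun z _ _ => D z)) a b s (lambda * s) g n a.
- by move=> u1 v1 w1 L1 L2; apply: conn_cat => *.
- move=> t t' tab t'ab tt'; have rt := gdeep t tab.
  have lt : lambda * mdist (g t) (g t') <= lambda * s by rewrite ler_pM2l.
  apply: conn_sub (lt) _; first apply: quasiconvex_link; first exact: Gg.
    have : 2 * (lambda * s) <= q * bdist G (g t).
      rewrite ls -(ler_pM2r (_ : 0 < 4 * c ^+ 2)); last by rewrite mulr_gt0.
      have -> : 2 * (q * rho / (8 * c ^+ 2)) * (4 * c ^+ 2) = q * rho.
        by field; rewrite gt_eqF.
      by rewrite -mulrA ler_pM2l// mulrC.
    by lra.
  by move=> z r r' _ [Gz tz]; split=> //; nra.
- exact: s0.
- exact: gcont.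
- exact: ain.
- move=> l sl lg; apply: (doubling_iter (k := k) (x := u) Xdbl QN s0 _ sl).
  move=> w /lg[t tab <-].
  have : mdist u (g t) <= c * mdist u v.
    by have := le_trans (mdist_curve_diam g ain tab) gdiam; rewrite lee_fin ga.
  have : c * mdist u v <= c * (2 * rho) by rewrite ler_pM2l.
  suff : 2 * c * rho < 2 ^+ k * s by lra.
  have -> : 2 * c * rho = 16 * c ^+ 3 * lambda / q * s.
    by rewrite /s; field; rewrite !gt_eqF.
  by rewrite ltr_pM2r.
move=> m mn; rewrite ga gb => cuv; apply: conn_sub cuv _ _.
  apply: (@le_trans _ _ (n%:R * rho)).
    apply: ler_pM; rewrite ?ler_nat//; first by apply: mulr_ge0; exact: ltW.
    rewrite ls ler_pdivrMr ?mulr_gt0//.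
    by apply: le_trans qrho _; rewrite ler_peMr ?(ltW rho0)//; lra.
  by rewrite ler_pM2r// lerDr mulr_ge0// ltW.
move=> z _ _ _ [Gz rz]; split=> //; apply: le_trans rz _.
by rewrite ler_wpM2r ?bdist_ge0// lerDl.
Qed.

(** Only length from [x] is constrained, so the old part is unaffected. On the new part that length
    is at most [C1 * rho], hence at most [C1 * C] times the depth. *)
Lemma cigar_extend (K C C1 rho L : R) x u v : 0 < rho ->
  0 <= C1 -> L + C * rho <= C1 * rho -> C1 * C <= K ->
  conn (fun z r _ => G z /\ r <= K * bdist G z) x u L ->
  conn (fun z _ _ => G z /\ rho <= C * bdist G z) u v (C * rho) ->
  conn (fun z r _ => G z /\ r <= K * bdist G z) x v (C1 * rho).
Proof.
move=> rho0 C10 LC CK xu uv.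
pose P z r (_ : R) := [/\ G z, r <= C * rho & rho <= C * bdist G z].
have uv' : conn P u v (C * rho).
  by apply: conn_sub uv (lexx _) _ => z r r' /andP[_ rC] [Gz rz].
apply: (conn_sub (L := L + C * rho) _ LC); last first.
  by move=> z r r' _ zr; exact: zr.
apply: conn_cat xu uv' => //.
move=> z r r' l /andP[_ lL] [Gz rC rz]; split=> //.
have : C1 * rho <= C1 * (C * bdist G z) by rewrite ler_wpM2l.
have : C1 * C * bdist G z <= K * bdist G z by rewrite ler_wpM2r// bdist_ge0.
by lra.
Qed.

(** Induction on the number [n] of halvings after which [x] is joined by local quasiconvexity alone.
    The constant [A = lambda + 2 * C] satisfies [A / 2 + C <= A], which sums the geometric
    series. *)
Lemma cigar_to_deep_point C x y u (rho : R) n :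
  1 <= C -> G x -> G y -> deep_connection C ->
  0 < rho -> 2 * rho <= mdist x y ->
  2 * lambda * rho <= 2 ^+ n * (q * bdist G x) ->
  G u -> mdist x u = rho -> rho <= c * bdist G u ->
  conn (fun z r _ => G z /\ r <= (lambda + 2 * C) * C * bdist G z) x u
    ((lambda + 2 * C) * rho).
Proof.
move=> C1 Gx Gy Cstep; have l0 : 0 < lambda by exact: lt_le_trans lambda1.
elim: n rho u => [|n IH] rho u rho0 rhoxy rhon Gu xu ru.
  (* Here the direct link has length at most half the depth of [x], and its points keep at least
     that depth. *)
  rewrite expr0 mul1r in rhon.
  have := @quasiconvex_link x u Gx; rewrite xu => /(_ rhon) xulink.
  have Crho : 0 <= C * rho by rewrite mulr_ge0 ?(ltW rho0)//; lra.
  apply: conn_sub xulink _ _; first by lra.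
  move=> z r _ /andP[_ rL] [Gz xz]; split=> //.
  have z0 := bdist_ge0 G z.
  have qx : q * bdist G x <= bdist G x by rewrite ger_pMl ?bdist_gt0// ltW.
  have : bdist G z <= (lambda + 2 * C) * C * bdist G z.
    by rewrite ler_peMl// mulr_ege1//; lra.
  by lra.
have rho20 : 0 < rho / 2 by rewrite divr_gt0.
have [|u' [Gu' xu' ru']] := @deep_point_at x y (rho / 2) Gx Gy rho20.
  by lra.
rewrite exprS in rhon.
have := IH (rho / 2) u' rho20 _ _ Gu' xu' ru'.
move=> /(_ ltac:(lra) ltac:(lra)) xuc.
have lrho := mulr_gt0 l0 rho0.
apply: (cigar_extend (C := C) rho0 _ _ _ xuc) => //; try lra.
have c0 : 0 < c by exact: lt_le_trans c1.
have cu : 0 <= c * bdist G u by rewrite mulr_ge0 ?bdist_ge0// ltW.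
apply: Cstep => //; try lra.
by have := metric_triangle u' x u; rewrite (metric_sym u' x) xu xu'; lra.
Qed.

Lemma distance_length_uniform : length_uniform G.
Proof.
have [C C1 Cstep] := deep_points_connected.
have c0 : 0 < c by exact: lt_le_trans c1.
have l0 : 0 < lambda by exact: lt_le_trans lambda1.
pose A := lambda + 2 * C; have A1 : 1 <= A by rewrite /A; lra.
have AC : 1 <= A * C by rewrite mulr_ege1.
have A_AC : A <= A * C by rewrite ler_peMr//; lra.
(* The final curve has length at most [3 / 2 * A * r]; the cigar condition alone would take
   [A * C]. *)
exists (2 * (A * C)); first by lra.
move=> x y Gx Gy; have [<-|xy] := eqVneq x y.
  exists 0, 0, (fun=> x).
  rewrite /rectifiable curve_lengthxx mdistxx mulr0; split=> //.
    split=> // [|_ [t _ <-]//].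
    by apply: continuous_subspaceT => t; exact: cvg_cst.
  move=> t; rewrite in_itv /= -eq_le => /eqP <-.
  by rewrite curve_lengthxx minxx lee_fin mulr_ge0 ?bdist_ge0//; lra.
pose r := mdist x y; have r0 : 0 < r by rewrite mdist_gt0.
have r20 : 0 < r / 2 by rewrite divr_gt0.
have cigar w w' : G w -> G w' -> mdist w w' = r -> exists u, [/\ G u,
    mdist w u = r / 2, r / 2 <= c * bdist G u &
    conn (fun z r _ => G z /\ r <= A * C * bdist G z) w u (A * (r / 2))].
  move=> Gw Gw' ww'; have rww' : 2 * (r / 2) <= mdist w w' by rewrite ww'; lra.
  have [u [Gu wu ru]] := deep_point_at Gw Gw' r20 rww'.
  have qw : 0 < q * bdist G w by rewrite mulr_gt0 ?bdist_gt0.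
  pose n := Num.bound (2 * lambda * (r / 2) / (q * bdist G w)).
  have hn : 2 * lambda * (r / 2) <= 2 ^+ n * (q * bdist G w).
    by rewrite -ler_pdivrMr// ltW// upper_nthrootP.
  exists u; split=> //.
  exact: (cigar_to_deep_point C1 Gw Gw' Cstep r20 rww' hn Gu wu ru).
have [u [Gu xu ru xuc]] := cigar x y Gx Gy erefl.
have [v [Gv yv rv yvc]] := cigar y x Gy Gx (metric_sym y x).
(* The points [u] and [v] were chosen at scale [r / 2]; the bridge is built at scale [r], since
   [mdist u v] can reach [2 * r]. *)
have uv : conn (fun z _ _ => G z /\ r <= C * bdist G z) u v (C * r).
  apply: Cstep => //; try lra.
  have := metric_triangle u x v; have := metric_triangle x y v.
  by rewrite (metric_sym u x) xu yv -/r; lra.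
have AC0 : 0 <= A by lra.
have LC : A * (r / 2) + C * r <= A * r.
  by have := mulr_gt0 l0 r0; rewrite /A; lra.
(* The bridge is charged to the side of [x]; only the cigar from [y], reversed, is measured towards
   [y]. *)
have xvc := cigar_extend r0 AC0 LC (lexx _) xuc uv.
have [] := @conn_length R X G
  (fun z s s' => s <= A * C * bdist G z \/ s' <= A * C * bdist G z)
  x y (A * r + A * (r / 2)).
  apply: conn_cat xvc (conn_rev yvc) => z s s' d _ [Gz zs]; split=> //.
    by left.
  by right.
move=> a [b [g [gi gL gcig]]].
have ACr : A * r <= A * C * r by rewrite ler_pM2r.
exists a, b, g; split=> //.
- exact: le_lt_trans gL (ltry _).
- apply: le_trans gL _; rewrite lee_fin -/r.
  by have := mulr_ge0 AC0 (ltW r0); lra.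
move=> t /gcig[s [s' [h ts ts']]].
have d0 : 0 <= A * C * bdist G (g t) by rewrite mulr_ge0 ?bdist_ge0//; lra.
rewrite ge_min; case: h => h; apply/orP; [left|right].
  by apply: le_trans ts _; rewrite lee_fin; lra.
by apply: le_trans ts' _; rewrite lee_fin; lra.
Qed.

End distance_to_length.

(** * Consequences of length uniformity *)

Section length_to_distance.
Context {R : realType} {X : metricType R} (G : set X).

Lemma curve_diam_le_length a b (g : R -> X) :
  (curve_diam a b g <= curve_length a b g)%E.
Proof.
apply: ge_ereal_sup => _ [_ [s + <-]] [_ [t + <-] <-].
rewrite /= !in_itv /= => /andP[als sb] /andP[at_ tb].
wlog st : s t als sb at_ tb / s <= t.
  by move=> H; have [|/ltW] := leP s t; [|rewrite metric_sym]; exact: H.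
apply: le_trans (le_curve_length g at_ tb).
apply: le_trans (curve_length_add g als st).
by rewrite leeDr// curve_length_ge0.
Qed.

Lemma length_diameter_uniform : length_uniform G -> diameter_uniform G.
Proof.
move=> [c c1 Gc]; exists c => // x y Gx Gy.
have [a [b [g [gi gr gL gcig]]]] := Gc x y Gx Gy.
exists a, b, g; split=> //.
  exact: le_trans (curve_diam_le_length _ _ _) gL.
move=> t /gcig; rewrite !ge_min => /orP[] gt; apply/orP; [left|right];
  exact: le_trans (curve_diam_le_length _ _ _) gt.
Qed.

Lemma diameter_distance_uniform : diameter_uniform G -> distance_uniform G.
Proof.
move=> [c c1 Gc]; exists c => // x y Gx Gy.
have [a [b [g [gi gr gL gcig]]]] := Gc x y Gx Gy.
exists a, b, g; split=> // t tab; have [ab _ <- <- _] := gi.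
move: (tab); rewrite in_itv /= => /andP[at_ tb].
have := gcig t tab; rewrite !ge_min => /orP[] gt; apply/orP; [left|right];
  rewrite -lee_fin; apply: le_trans gt; apply: mdist_curve_diam;
  by rewrite in_itv /= lexx ?at_ ?tb.
Qed.

Lemma length_locally_quasiconvex : length_uniform G -> locally_quasiconvex G.
Proof.
(* A ball of radius half the depth stays in [G], where the length bound of uniform curves is
   quasiconvexity with constant [c]. *)
move=> [c c1 Gc]; exists (1 / 2), c; split=> //; try lra.
split=> [x y Gx Gy|x y z Gx].
  by have [a [b [g [gi gr _ _]]]] := Gc x y Gx Gy; exists a, b, g.
have mem w : ball x (1 / 2 * bdist G x) w -> G w.
  rewrite ballEmdist /= => xw; apply: mem_lt_bdist (lt_le_trans xw _).
  by have := bdist_ge0 G x; lra.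
move=> /mem Gy /mem Gz; have [a [b [g [gi _ gL _]]]] := Gc y z Gy Gz.
by exists a, b, g.
Qed.

End length_to_distance.

Theorem theorem1p2 (R : realType) (X : metricType R) (Q : R) (G : set X)
    (hQ : 1 < Q) (hX : doubling X Q) (hG : domain G) (hGX : G `<` [set: X]) :
  (length_uniform G <-> diameter_uniform G /\ locally_quasiconvex G) /\
  (length_uniform G <-> distance_uniform G /\ locally_quasiconvex G).
Proof.
(* Both converses reduce to this one, as diameter uniformity implies distance uniformity. *)
have dist_length : distance_uniform G -> locally_quasiconvex G ->
    length_uniform G.
  have [_ oG _] := hG; have [_ /nonsubset[w [_ Gw]]] := hGX.
  move=> [c c1 Gc] [q [lambda [q0 q1 lambda1 Gqc]]].
  by apply: distance_length_uniform hX oG _ q0 q1 lambda1 c1 Gqc Gc; exists w.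
split; split.
- by move=> Gl; split; [exact: length_diameter_uniform|
    exact: length_locally_quasiconvex].
- by move=> [/diameter_distance_uniform]; exact: dist_length.
- move=> Gl; split; last exact: length_locally_quasiconvex.
  exact/diameter_distance_uniform/length_diameter_uniform.
- by move=> []; exact: dist_length.
Qed.
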